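(* Let $\mathcal A=\{\vec A^{(1)},\dots,\vec A^{(R)}\}$ and $\mathcal B=\{\vec B^{(1)},\dots,\vec B^{(R)}\}$ be families of ensembles of real random variables, $\vec A^{(i)}=(a^{(i)}_1,\dots,a^{(i)}_{k_i})$, $\vec B^{(i)}=(b^{(i)}_1,\dots,b^{(i)}_{k_i})$, such that: for each $i\in[R]$ the ensembles $\vec A^{(i)}$ and $\vec B^{(i)}$ have matching moments up to degree $3$; all random variables in $\mathcal A$ and $\mathcal B$ are bounded by $1$ in absolute value; the ensembles $\vec A^{(1)},\dots,\vec A^{(R)}$ are mutually independent, and likewise $\vec B^{(1)},\dots,\vec B^{(R)}$ are mutually independent. Let $\vec l^{(i)}\in\mathbb R^{k_i}$ for $i\in[R]$ and define $\vec l(\vec x)=\sum_{i\in[R]}\langle\vec l^{(i)},\vec x^{(i)}\rangle$. Then: (1) for every $K$-bounded function $\Psi:\mathbb R\to\mathbb R$ and every $\theta\in\mathbb R$, $$\Big|\mathbb E_{\mathcal A}[\Psi(\vec l(\mathcal A)-\theta)]-\mathbb E_{\mathcal B}[\Psi(\vec l(\mathcal B)-\theta)]\Big|\le K\sum_{i\in[R]}\|\vec l^{(i)}\|_1^4;$$ (2) there is an absolute constant $C$ such that for every $0<\alpha<1/2$ and every $\tilde\theta\in\mathbb R$, $$\Big|\mathbb E_{\mathcal A}[\mathrm{sgn}(\vec l(\mathcal A)-\tilde\theta)]-\mathbb E_{\mathcal B}[\mathrm{sgn}(\vec l(\mathcal B)-\tilde\theta)]\Big|\le \frac{C}{\alpha^4}\sum_{i\in[R]}\|\vec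 l^{(i)}\|_1^4+2c(\alpha),$$ where $c(\alpha)=\max\big(\sup_{\theta}\Pr_{\mathcal A}[\vec l(\mathcal A)\in[\theta-\alpha,\theta+\alpha]],\ \sup_\theta\Pr_{\mathcal B}[\vec l(\mathcal B)\in[\theta-\alpha,\theta+\alpha]]\big)$.
   Context: $\mathrm{sgn}(t)=1$ if $t\ge0$ and $0$ otherwise. A function $\Psi:\mathbb R\to\mathbb R$ whose fourth derivative exists everywhere is $K$-bounded if $|\Psi''''(t)|\le K$ for all $t\in\mathbb R$. Two ensembles $(p_1,\dots,p_k)$ and $(q_1,\dots,q_k)$ of random variables have matching moments up to degree $d$ if $\mathbb E[\prod_{i\in S}p_i]=\mathbb E[\prod_{i\in S}q_i]$ for every multiset $S$ of elements of $[k]$ with $|S|\le d$. *)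

(* Defs.v *)
From HB Require Import structures.
From mathcomp Require Import all_boot all_order all_algebra.
From mathcomp Require Import all_classical all_reals all_analysis.
Set Implicit Arguments. Unset Strict Implicit. Unset Printing Implicit Defensive.
Import Order.TTheory GRing.Theory Num.Theory.
Import numFieldNormedType.Exports.
Local Open Scope classical_set_scope.
Local Open Scope ring_scope.

Definition sgn {R : realType} (t : R) : R := if 0 <= t then 1 else 0.

Definition K_bounded {R : realType} (K : R) (Psi : R -> R) : Prop :=
  (forall n : nat, (n < 4)%N -> forall x : R, derivable (derive1n n Psi) x 1) /\
  (forall x : R, `|derive1n 4 Psi x| <= K).

Definition ens_sigma {T : Type} {R : realType} (k : nat) (X : 'I_k -> T -> R)
  : set (set T) :=
  <<s [set E | exists j : 'I_k, exists B : set R, measurable B /\ E = X j @^-1` B] >>.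

Definition mutually_independent_ensembles {d} {T : measurableType d} {R : realType}
  (P : probability T R) (n : nat) (k : 'I_n -> nat)
  (X : forall i : 'I_n, 'I_(k i) -> T -> R) : Prop :=
  forall (S : {set 'I_n}) (E : 'I_n -> set T),
    (forall i, i \in S -> ens_sigma (X i) (E i)) ->
    P (\bigcap_(i in [set i | i \in S]) E i) = (\prod_(i in S) P (E i))%E.

(* matching moments up to degree d: for every multiset S (a sequence) of
   indices with |S| <= d, E[prod_{j in S} X_j] = E[prod_{j in S} Y_j]. *)
Definition matching_moments {d1 d2} {T1 : measurableType d1} {T2 : measurableType d2}
  {R : realType} (P1 : probability T1 R) (P2 : probability T2 R) (k : nat)
  (X : 'I_k -> T1 -> R) (Y : 'I_k -> T2 -> R) (deg : nat) : Prop :=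
  forall s : seq 'I_k, (size s <= deg)%N ->
    ('E_P1[fun w => (\prod_(j <- s) X j w)%R] = 'E_P2[fun w => (\prod_(j <- s) Y j w)%R])%E.

Definition lin_form {T : Type} {R : realType} (n : nat) (k : 'I_n -> nat)
  (l : forall i : 'I_n, 'I_(k i) -> R) (X : forall i : 'I_n, 'I_(k i) -> T -> R)
  (w : T) : R :=
  \sum_(i < n) \sum_(j < k i) l i j * X i j w.

Definition norm1 {R : realType} (k : nat) (v : 'I_k -> R) : R :=
  \sum_(j < k) `|v j|.

Definition max_interval_prob {d} {T : measurableType d} {R : realType}
  (P : probability T R) (L : T -> R) (alpha : R) : \bar R :=
  ereal_sup [set P [set w | theta - alpha <= L w <= theta + alpha] | theta in [set: R]].

(* Main.v *)
(** Lindeberg's replacement method.  The sums [<l_i, A_i>] are independent real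
variables bounded by [|l_i|_1], and those built from [A_i] and [B_i] have the
same moments up to order three.  Exchanging them one index at a time inside
[Psi], independence makes the rest of the sum a constant [z], and the
third-order Taylor expansion of [Psi] at [z] shows that one exchange costs at
most [2 K |l_i|_1^4 / 4!].  For the sign function, [Psi] is a smooth
step with fourth derivative [O(alpha^-4)]; it differs from [sgn] only on
[[-alpha, alpha]], which costs at most the concentration [c(alpha)] on each
side. *)

Require Import Defs.
From HB Require Import structures.
From mathcomp Require Import all_boot all_order all_algebra.
From mathcomp Require Import all_classical all_reals all_analysis.
From mathcomp Require Import measurable_realfun.
From mathcomp Require Import ring lra.
Set Implicit Arguments.
Unset Strict Implicit.
Unset Printing Implicit Defensive.
Import Order.TTheory GRing.Theory Num.Theory.
Import numFieldNormedType.Exports.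
Local Open Scope classical_set_scope.
Local Open Scope ring_scope.

(** * Bounded random variables and independence *)

(** The two families live on different probability spaces, so no single variable mixes them: a
    hybrid sum exists only under an iterated integral over [PA] and [PB], and working with bounded
    integrands makes every Fubini exchange legitimate.

    Independence is given for events of the sigma-algebras of the ensembles, whereas an exchange
    needs a partial sum to be independent of the next variable. Partial sums are therefore built one
    variable at a time, with the events of all remaining variables carried along, and laws are
    compared on measurable rectangles.

    A [K_bounded] function may be unbounded, and its fourth derivative need not be continuous. Hence
    [Psi] is cut off outside a compact interval that contains every argument that occurs, and
    Taylor's bound rests on the mean value theorem instead of an integral remainder.

    The smooth step is a polynomial composed with clamping to [[-1, 1]]; its fourth derivative is
    controlled by that of the polynomial on this interval, and such a bound is the absolute constant
    of the sign estimate. *)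

Section bounded_measurable.
Context d (T : measurableType d) (R : realType).
Implicit Types (P : probability T R) (f g : T -> R).

(** Boundedness rather than integrability: this class is closed under products, and all its members
    are integrable for any probability. *)
Definition bounded_measurable (f : T -> R) : Prop :=
  measurable_fun [set: T] f /\ exists M, forall x, `|f x| <= M.

Lemma bounded_measurable_integrable P f :
  bounded_measurable f -> P.-integrable [set: T] (EFin \o f).
Proof.
move=> [mf [M fM]]; apply: measurable_bounded_integrable => //.
  by rewrite [X in (X < _)%E]probability_setT ltry.
exists M; split; first exact: num_real.
by move=> y My x _ /=; exact: le_trans (fM x) (ltW My).
Qed.

Lemma expectation_Rintegral P f : bounded_measurable f ->
  'E_P[f]%E = (\int[P]_x f x)%:E.
Proof.
move=> bf; rewrite unlock /Rintegral fineK//.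
exact: integrable_fin_num (bounded_measurable_integrable P bf).
Qed.

Lemma normr_Rintegral_le P f M : bounded_measurable f ->
  (forall x, `|f x| <= M) -> `|\int[P]_x f x| <= M.
Proof.
move=> bf fM; apply: le_trans (le_normr_Rintegral measurableT _) _.
  exact: bounded_measurable_integrable.
rewrite -[leRHS]mulr1 -[X in M * X](_ : fine (P setT) = 1); last first.
  by rewrite probability_setT.
rewrite -Rintegral_cst//; apply: le_Rintegral => //.
- apply: bounded_measurable_integrable; case: bf => mf [N fN]; split.
    exact: measurableT_comp.
  by exists N => x; rewrite normr_id.
- by apply: bounded_measurable_integrable; split => //; exists `|M|.
Qed.

Lemma bounded_measurableD f g : bounded_measurable f -> bounded_measurable g ->
  bounded_measurable (fun x => f x + g x).
Proof.
move=> [mf [M fM]] [mg [N gN]]; split; first exact: measurable_funD.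
by exists (M + N) => x; rewrite (le_trans (ler_normD _ _))// lerD.
Qed.

Lemma bounded_measurableM f g : bounded_measurable f -> bounded_measurable g ->
  bounded_measurable (fun x => f x * g x).
Proof.
move=> [mf [M fM]] [mg [N gN]]; split; first exact: measurable_funM.
by exists (M * N) => x; rewrite normrM ler_pM.
Qed.

Lemma bounded_measurableB f g : bounded_measurable f -> bounded_measurable g ->
  bounded_measurable (fun x => f x - g x).
Proof.
move=> [mf [M fM]] [mg [N gN]]; split; first exact: measurable_funB.
by exists (M + N) => x; rewrite (le_trans (ler_normB _ _))// lerD.
Qed.

Lemma bounded_measurable_cst (r : R) : bounded_measurable (fun=> r).
Proof. by split => //; exists `|r|. Qed.

Lemma bounded_measurableX f m : bounded_measurable f ->
  bounded_measurable (fun x => f x ^+ m).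
Proof.
move=> bf; elim: m => [|m IH].
  by under eq_fun do rewrite expr0; exact: bounded_measurable_cst.
by under eq_fun do rewrite exprS; exact: bounded_measurableM.
Qed.

Lemma bounded_measurable_prod (I : Type) (s : seq I) (F : I -> T -> R) :
  (forall i, bounded_measurable (F i)) ->
  bounded_measurable (fun x => \prod_(i <- s) F i x).
Proof.
move=> bF; elim: s => [|i s IH].
  by under eq_fun do rewrite big_nil; exact: bounded_measurable_cst.
by under eq_fun do rewrite big_cons; exact: bounded_measurableM.
Qed.

Lemma bounded_measurable_sum (I : Type) (s : seq I) (Q : pred I) (F : I -> T -> R) :
  (forall i, bounded_measurable (F i)) ->
  bounded_measurable (fun x => \sum_(i <- s | Q i) F i x).
Proof.
move=> bF; elim: s => [|i s IH].
  by under eq_fun do rewrite big_nil; exact: bounded_measurable_cst.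
under eq_fun do rewrite big_cons; case: (Q i) => //.
exact: bounded_measurableD.
Qed.

Lemma bounded_measurable_comp (g : R -> R) f :
  measurable_fun [set: R] g -> (exists M, forall x, `|g x| <= M) ->
  measurable_fun [set: T] f -> bounded_measurable (fun x => g (f x)).
Proof.
by move=> mg [M gM] mf; split; [exact: measurableT_comp|exists M].
Qed.

Lemma Rintegral_prob_cst P (r : R) : \int[P]_x r = r.
Proof. by rewrite Rintegral_cst// [X in fine X]probability_setT mulr1. Qed.

End bounded_measurable.

Lemma bounded_measurable_Rintegral d1 d2 (T1 : measurableType d1)
    (T2 : measurableType d2) (R : realType) (P : probability T2 R)
    (g : T1 * T2 -> R) :
  bounded_measurable g -> bounded_measurable (fun x => \int[P]_y g (x, y)).
Proof.
move=> [mg [M gM]].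
have bg x : bounded_measurable (fun y => g (x, y)).
  by split; [exact: measurableT_comp|exists M].
split; last by exists M => x; exact: normr_Rintegral_le.
(* Tonelli's measurability statement needs a nonnegative integrand. *)
have shift x :
    \int[P]_y g (x, y) = fine (\int[P]_y (g (x, y) + M)%:E)%E - M.
  rewrite -[X in _ = X - _]/(\int[P]_y (g (x, y) + M)) RintegralD//.
  - by rewrite Rintegral_prob_cst addrK.
  - exact: bounded_measurable_integrable.
  - exact/bounded_measurable_integrable/bounded_measurable_cst.
under eq_fun do rewrite shift.
apply: measurable_funB => //; apply: measurableT_comp => //.
apply: (@measurable_fun_fubini_tonelli_F _ _ _ _ _ P
  (fun z => (g z + M)%:E)) => //.
  exact/measurable_EFinP/measurable_funD.
by move=> z; rewrite lee_fin -lerBlDr sub0r; have := gM z; rewrite ler_norml => /andP[].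
Qed.

Section Fubini.
Context d1 d2 (T1 : measurableType d1) (T2 : measurableType d2) (R : realType).
Variables (P1 : probability T1 R) (P2 : probability T2 R).
Variable g : T1 * T2 -> R.
Hypothesis bg : bounded_measurable g.

Let ig : (P1 \x P2)%E.-integrable [set: T1 * T2] (EFin \o g).
Proof. exact: (bounded_measurable_integrable (P1 \x P2)%E bg). Qed.

Let bg1 x : bounded_measurable (fun y => g (x, y)).
Proof.
by case: bg => mg [M gM]; split; [exact: measurableT_comp|exists M].
Qed.

Let bg2 y : bounded_measurable (fun x => g (x, y)).
Proof.
by case: bg => mg [M gM]; split; [exact: measurableT_comp|exists M].
Qed.

Let fineF x : (\int[P2]_y (g (x, y))%:E)%E = (\int[P2]_y g (x, y))%:E.
Proof.
rewrite /Rintegral fineK//.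
exact: integrable_fin_num (bounded_measurable_integrable P2 (bg1 x)).
Qed.

Let fineG y : (\int[P1]_x (g (x, y))%:E)%E = (\int[P1]_x g (x, y))%:E.
Proof.
rewrite /Rintegral fineK//.
exact: integrable_fin_num (bounded_measurable_integrable P1 (bg2 y)).
Qed.

Lemma Rintegral_product :
  \int[(P1 \x P2)%E]_z g z = \int[P1]_x \int[P2]_y g (x, y).
Proof.
rewrite /Rintegral -(integral12_prod_meas1 ig); congr fine.
by apply: eq_integral => x _; exact: fineF.
Qed.

Lemma Rintegral_Fubini :
  \int[P1]_x \int[P2]_y g (x, y) = \int[P2]_y \int[P1]_x g (x, y).
Proof.
rewrite -Rintegral_product /Rintegral -(integral21_prod_meas1 ig); congr fine.
by apply: eq_integral => y _; exact: fineG.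
Qed.

End Fubini.

(** * Product laws and independence of partial sums *)

Section product_law.
Context d (T : measurableType d) (R : realType) (P : probability T R).
Variables S X : {mfun T >-> R}.

(* Carrying the event [W] lets independence from the remaining variables
   survive when [S] and [X] are replaced by their sum. *)
Lemma product_law (W : set T) : measurable W ->
  (forall U V, measurable U -> measurable V ->
    P (S @^-1` U `&` X @^-1` V `&` W) =
    (P (S @^-1` U) * P (X @^-1` V) * P W)%E) ->
  forall E : set (R * R), measurable E ->
    P ([set w | E (S w, X w)] `&` W) =
    ((distribution P S \x distribution P X) E * P W)%E.
Proof.
move=> mW indep E mE.
have mSX : measurable_fun [set: T] (fun w => (S w, X w)).
  exact: measurable_fun_pair.
have PWge0 : 0 <= fine (P W) by rewrite fine_ge0.
(* Both sides are finite measures in [E]. They agree on measurable rectangles, a pi-system that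
   generates the product sigma-algebra, hence everywhere. *)
pose m1 : {measure set (R * R) -> \bar R} :=
  mscale (NngNum PWge0) (distribution P S \x distribution P X)%E.
pose m2 : {measure set (R * R) -> \bar R} :=
  pushforward (mrestr P mW) (fun w => (S w, X w)).
pose C : set (set (R * R)) :=
  [set C | exists2 A, measurable A & exists2 B, measurable B & A `*` B = C].
rewrite muleC -[P W]fineK ?fin_num_measure//.
rewrite -[RHS]/(m1 E) -[LHS]/(m2 mSX E); symmetry.
apply: (measure_unique C (fun=> setT)) => //.
- by rewrite measurable_prod_measurableType.
- move=> _ _ [A1 mA1 [B1 mB1 <-]] [A2 mA2 [B2 mB2 <-]].
  rewrite -setXI; exists (A1 `&` A2); first exact: measurableI.
  by exists (B1 `&` B2) => //; exact: measurableI.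
- by move=> _; exists setT => //; exists setT => //; rewrite setXTT.
- by rewrite bigcup_const//; exists 0%N.
- move=> _ [A mA [B mB <-]].
  rewrite -[LHS]/((fine (P W))%:E * (_ \x _) (A `*` B))%E.
  rewrite product_measure1E// fineK ?fin_num_measure//.
  by rewrite [RHS](indep A B)// muleC.
- move=> _; rewrite -[X in (X < _)%E]/((fine (P W))%:E * (_ \x _) setT)%E.
  by rewrite probability_setT mule1 ltry.
Qed.

End product_law.

Section independence.
Context d (T : measurableType d) (R : realType) (P : probability T R).

Definition independent_pair (S X : T -> R) : Prop :=
  forall U V, measurable U -> measurable V ->
    P (S @^-1` U `&` X @^-1` V) = (P (S @^-1` U) * P (X @^-1` V))%E.

(** The joint law of [(S, X)] is the product of the two laws, so the integral over the plane becomes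
    an iterated one. Pulled back to [T], the second variable [v] makes [X v] an independent copy of
    [X]. *)
Lemma Rintegral_independent_pair (S X : T -> R) (g : R * R -> R) :
  measurable_fun [set: T] S -> measurable_fun [set: T] X ->
  independent_pair S X -> bounded_measurable g ->
  \int[P]_w g (S w, X w) = \int[P]_w \int[P]_v g (S w, X v).
Proof.
move=> mS mX indep bg.
pose S' : {mfun T >-> R} := HB.pack S (isMeasurableFun.Build _ _ _ _ _ mS).
pose X' : {mfun T >-> R} := HB.pack X (isMeasurableFun.Build _ _ _ _ _ mX).
have mSX : measurable_fun [set: T] (fun w => (S w, X w)).
  exact: measurable_fun_pair.
pose SX : {mfun T >-> (R * R)%type} :=
  HB.pack (fun w => (S w, X w)) (isMeasurableFun.Build _ _ _ _ _ mSX).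
have law E : measurable E ->
    P [set w | E (S w, X w)] = (distribution P S' \x distribution P X')%E E.
  move=> mE; rewrite -[LHS]/(P ([set w | E (S' w, X' w)])).
  rewrite -[X in P X]setIT product_law//.
    by rewrite probability_setT mule1.
  by move=> U V mU mV; rewrite setIT probability_setT mule1; exact: indep.
have [mg [M gM]] := bg.
have RdistE d' (T' : measurableType d') (Z : {mfun T >-> T'}) (h : T' -> R) :
    bounded_measurable h -> \int[distribution P Z]_z h z = \int[P]_w h (Z w).
  move=> [mh [N hN]]; rewrite /Rintegral; congr fine.
  rewrite integral_distribution//; first exact/measurable_EFinP.
  rewrite -[_ \o _]/(EFin \o (h \o Z)); apply: bounded_measurable_integrable.
  by split; [exact: measurableT_comp|exists N => x /=].
transitivity (\int[(distribution P S' \x distribution P X')%E]_z g z).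
  rewrite -[LHS](RdistE _ _ SX)//.
  rewrite /Rintegral; congr fine; apply: eq_measure_integral => /= A mA _.
  exact: law.
rewrite Rintegral_product// RdistE; last first.
  exact: (bounded_measurable_Rintegral (distribution P X') bg).
apply: eq_Rintegral => w _ /=; rewrite RdistE//.
by split; [exact: measurableT_comp|exists M].
Qed.

End independence.

Lemma finset_ind (T : finType) (Q : {set T} -> Prop) :
  Q finset.set0 ->
  (forall (i : T) (D : {set T}), i \notin D -> Q D -> Q (i |: D)%SET) ->
  forall D, Q D.
Proof.
move=> Q0 QU D; have [m] := ubnP #|D|; elim: m D => // m IH D.
have [->//|[i iD]] := finset.set_0Vmem D.
rewrite (cardsD1 i) iD add1n ltnS => Dm.
by rewrite -(finset.setD1K iD); apply: QU; [rewrite !inE eqxx|exact: IH].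
Qed.

Section independent_family.
Context d (T : measurableType d) (R : realType) (P : probability T R).
Context (n : nat) (X : 'I_n -> T -> R).
Hypothesis mX : forall i, measurable_fun [set: T] (X i).

(** One equation over all indices is enough: choosing [V i] to be [setT] recovers every
    subfamily. *)
Definition independent_family : Prop :=
  forall V : 'I_n -> set R, (forall i, measurable (V i)) ->
    P (\bigcap_i (X i @^-1` V i)) = (\prod_(i < n) P (X i @^-1` V i))%E.

Definition subset_sum (D : {set 'I_n}) (w : T) : R := \sum_(i in D) X i w.

Lemma measurable_subset_sum D : measurable_fun [set: T] (subset_sum D).
Proof.
rewrite /subset_sum; under eq_fun do rewrite big_mkcond.
by apply: measurable_sum => i; case: (i \in D).
Qed.

Lemma subset_sumU1 i (D : {set 'I_n}) w : i \notin D ->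
  subset_sum (i |: D)%SET w = X i w + subset_sum D w.
Proof. by move=> iD; rewrite /subset_sum big_setU1. Qed.

Let mpre i (V : set R) : measurable V -> measurable (X i @^-1` V).
Proof. by move=> mV; rewrite -[_ @^-1` _]setTI; exact: mX. Qed.

(** Induction on [D]. Moving [i] into [D] requires the joint law of [subset_sum D] and [X i] on an
    event of the other variables, which is the setting of [product_law]; keeping all variables
    outside [D] in the statement makes the induction hypothesis strong enough for this. *)
Lemma independent_subset_sum : independent_family ->
  forall (D : {set 'I_n}) (U : set R) (V : 'I_n -> set R),
    measurable U -> (forall i, measurable (V i)) ->
    P (subset_sum D @^-1` U `&`
       \bigcap_(i in [set i | i \notin D]) (X i @^-1` V i)) =
    (P (subset_sum D @^-1` U) * \prod_(i | i \notin D) P (X i @^-1` V i))%E.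
Proof.
move=> indep; elim/finset_ind => [|i D iD IH] U V mU mV.
  rewrite (_ : subset_sum _ = cst 0); last first.
    by apply/funext => w; rewrite /subset_sum big_set0.
  rewrite preimage_cst; case: ifPn => _; last first.
    by rewrite set0I !measure0 mul0e.
  rewrite setTI probability_setT mul1e.
  under eq_bigl do rewrite inE.
  rewrite -indep//; congr (P _).
  by apply/seteqP; split => [w Vw j _|w Vw j _]; apply: Vw; rewrite //= inE.
pose W (V : 'I_n -> set R) : set T :=
  \bigcap_(j in [set j | j \notin (i |: D)%SET]) (X j @^-1` V j).
have mW V' : (forall j, measurable (V' j)) -> measurable (W V').
  by move=> mV'; apply: fin_bigcap_measurable => // j _; exact: mpre.
(* Prescribing the event of [X i] separately splits the indices outside [D] into [i] and those that
   define [W]. *)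
pose upd (V : 'I_n -> set R) B j := if j == i then B else V j.
have mupd V' B : (forall j, measurable (V' j)) -> measurable B ->
    forall j, measurable (upd V' B j).
  by move=> mV' mB j; rewrite /upd; case: ifP.
have cap_upd V' B : \bigcap_(j in [set j | j \notin D]) (X j @^-1` upd V' B j)
    = X i @^-1` B `&` W V'.
  apply/seteqP; split => [w Vw|w [Bw Vw] j /= jD].
    split; first by have := Vw i iD; rewrite /upd eqxx.
    move=> j /=; rewrite !inE negb_or => /andP[ji jD].
    by have := Vw j jD; rewrite /upd (negbTE ji).
  rewrite /upd; case: eqP => [->//|/eqP ji].
  by apply: Vw; rewrite /= !inE negb_or ji.
have prod_upd V' B : (\prod_(j | j \notin D) P (X j @^-1` upd V' B j) =
    P (X i @^-1` B) * \prod_(j | j \notin (i |: D)%SET) P (X j @^-1` V' j))%E.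
  rewrite (bigD1 i)//= /upd eqxx; congr (_ * _)%E.
  apply: eq_big => [j|j /andP[_ /negbTE ->]//].
  by rewrite !inE negb_or andbC.
have PW V' : (forall j, measurable (V' j)) ->
    P (W V') = (\prod_(j | j \notin (i |: D)%SET) P (X j @^-1` V' j))%E.
  (* Trivial events for the sum and for [X i] leave the independence of the remaining variables
     alone. *)
  move=> mV'; have := IH setT (upd V' setT) measurableT (mupd _ _ mV' measurableT).
  by rewrite cap_upd prod_upd !preimage_setT !setTI !probability_setT !mul1e.
pose S' : {mfun T >-> R} :=
  HB.pack (subset_sum D) (isMeasurableFun.Build _ _ _ _ _ (measurable_subset_sum D)).
pose X' : {mfun T >-> R} := HB.pack (X i) (isMeasurableFun.Build _ _ _ _ _ (mX i)).
pose E : set (R * R) := [set z | U (z.2 + z.1)].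
have mE : measurable E.
  rewrite -[E]setTI; apply: (@measurable_funD _ _ R setT snd fst) => //.
have sumW V' : (forall j, measurable (V' j)) ->
    P (subset_sum (i |: D)%SET @^-1` U `&` W V') =
    ((distribution P S' \x distribution P X') E * P (W V'))%E.
  move=> mV'; rewrite -product_law//; last 2 first.
  - exact: mW.
  - move=> A B mA mB; rewrite PW// -muleA -prod_upd -setIA -cap_upd.
    by rewrite IH//; exact: mupd.
  congr (P (_ `&` _)); apply/funext => w /=.
  by rewrite /E /= subset_sumU1.
rewrite sumW// -PW//; congr (_ * _)%E.
(* With all events trivial, [sumW] identifies the product measure of [E] with the probability that
   the enlarged sum lies in [U]. *)
have := sumW (fun=> setT) (fun=> measurableT).
have -> : W (fun=> setT) = setT.
  by apply/seteqP; split => // w _ j _; rewrite preimage_setT.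
by rewrite setIT probability_setT mule1.
Qed.

Lemma independent_pair_subset_sum (i : 'I_n) (D : {set 'I_n}) :
  independent_family -> i \notin D -> independent_pair P (subset_sum D) (X i).
Proof.
move=> indep iD U V mU mV.
pose V' j := if j == i then V else setT.
have mV' j : measurable (V' j) by rewrite /V'; case: ifP.
have := independent_subset_sum indep D mU mV'.
rewrite (bigD1 i)//= big1 ?mule1; last first.
  by move=> j /andP[_ /negbTE ji]; rewrite /V' ji preimage_setT probability_setT.
rewrite /V' eqxx => <-; congr (P (_ `&` _)).
apply/seteqP; split => [w Vw j _|w /(_ i iD)]; last by rewrite eqxx.
by case: eqP => [->|].
Qed.

End independent_family.

(** Independence speaks of events of [ens_sigma], so the linear form must be measurable for the
    generated sigma-algebra, not merely for that of [T]. *)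
Lemma ens_sigma_lin d (T : measurableType d) (R : realType) (k : nat)
    (X : 'I_k -> T -> R) (v : 'I_k -> R) (V : set R) : measurable V ->
  ens_sigma X ((fun w => \sum_(j < k) v j * X j w) @^-1` V).
Proof.
move=> mV.
pose G : set (set T) := [set E | exists j : 'I_k, exists B : set R,
  measurable B /\ E = X j @^-1` B].
suff : measurable_fun [set: g_sigma_algebraType G]
    (fun w : g_sigma_algebraType G => \sum_(j < k) v j * X j w).
  by move=> /(_ measurableT V mV); rewrite setTI.
apply: measurable_sum => j; apply: measurable_funM => // _ B mB.
by rewrite setTI; apply: sub_sigma_algebra; exists j, B.
Qed.

Lemma independent_lin d (T : measurableType d) (R : realType)
    (P : probability T R) (n : nat) (k : 'I_n -> nat)
    (A : forall i : 'I_n, 'I_(k i) -> T -> R)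
    (l : forall i : 'I_n, 'I_(k i) -> R) :
   mutually_independent_ensembles P A ->
  independent_family P (fun i w => \sum_(j < k i) l i j * A i j w).
Proof.
move=> indep V mV.
have /(_ (fun i => (fun w => \sum_(j < k i) l i j * A i j w) @^-1` V i)) :=
  indep finset.setT.
under eq_bigl do rewrite inE.
move=> <- => [|i _]; last exact: ens_sigma_lin.
by congr (P _); apply/seteqP; split => [w Vw j _|w Vw j _]; apply: Vw;
  rewrite //= inE.
Qed.

(** * Replacement *)

Section Lindeberg.
Context d1 d2 (T1 : measurableType d1) (T2 : measurableType d2) (R : realType).
Variables (PA : probability T1 R) (PB : probability T2 R) (n : nat).
Variables (X : 'I_n -> T1 -> R) (Y : 'I_n -> T2 -> R) (b eps : 'I_n -> R).
Variable f : R -> R.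
Hypotheses (mX : forall i, measurable_fun [set: T1] (X i))
  (mY : forall i, measurable_fun [set: T2] (Y i)).
Hypotheses (Xb : forall i w, `|X i w| <= b i) (Yb : forall i w, `|Y i w| <= b i).
Hypotheses (indepX : independent_family PA X) (indepY : independent_family PB Y).
Hypothesis bf : bounded_measurable f.
Hypothesis swap : forall i z, `|z| <= \sum_(j < n) b j ->
  `|\int[PA]_w f (z + X i w) - \int[PB]_w f (z + Y i w)| <= eps i.

Let S := subset_sum X.
Let U := subset_sum Y.

(** Indices in [D] use [X], the others [Y]. With subsets as indices, one exchange is the passage
    from [D] to [i |: D]. *)
Let hybrid (D : {set 'I_n}) : R :=
  \int[PA]_w \int[PB]_v f (S D w + U (~: D)%SET v).

Let bcomp d (T : measurableType d) (g : T -> R) :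
  measurable_fun [set: T] g -> bounded_measurable (fun x => f (g x)).
Proof. by move=> mg; case: bf => mf fM; exact: bounded_measurable_comp. Qed.

Let mS D : measurable_fun [set: T1] (S D).
Proof. exact: measurable_subset_sum. Qed.

Let mU D : measurable_fun [set: T2] (U D).
Proof. exact: measurable_subset_sum. Qed.

(** With [C] the complement of [i |: D], both hybrids share the partial sum [S D + U C]. Averaging
    over [X i] or [Y i] alone turns them into integrals of [GX] and [GY] at this common point, where
    [swap] applies. *)
Let hybrid_swap i (D : {set 'I_n}) : i \notin D ->
  `|hybrid (i |: D)%SET - hybrid D| <= eps i.
Proof.
move=> iD; pose C := (~: (i |: D))%SET.
have iC : i \notin C by rewrite !inE eqxx.
have DC : (~: D)%SET = (i |: C)%SET.
  apply/setP => j; rewrite !inE; case: eqP => [->|_] //=.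
pose GX z := \int[PA]_x f (z + X i x).
pose GY z := \int[PB]_y f (z + Y i y).
have bGX : bounded_measurable GX.
  apply: (bounded_measurable_Rintegral PA
    (g := fun p : R * T1 => f (p.1 + X i p.2))).
  by apply/bcomp/measurable_funD => //; exact: measurableT_comp.
have bGY : bounded_measurable GY.
  apply: (bounded_measurable_Rintegral PB
    (g := fun p : R * T2 => f (p.1 + Y i p.2))).
  by apply/bcomp/measurable_funD => //; exact: measurableT_comp.
(* Independence from [S D] lets [X i] be integrated as a separate copy; Fubini then moves that
   integral inside the one over [PB]. *)
have hX : hybrid (i |: D)%SET = \int[PA]_w \int[PB]_v GX (S D w + U C v).
  pose g (p : R * R) := \int[PB]_v f (p.1 + p.2 + U C v).
  have bg : bounded_measurable g.
    apply: (bounded_measurable_Rintegral PB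
      (g := fun q : (R * R) * T2 => f (q.1.1 + q.1.2 + U C q.2))).
    apply/bcomp/measurable_funD; last exact: measurableT_comp.
    by apply: measurable_funD; apply: measurableT_comp.
  transitivity (\int[PA]_w g (S D w, X i w)).
    apply: eq_Rintegral => w _; apply: eq_Rintegral => v _.
    by rewrite /S subset_sumU1//= [X i w + _]addrC.
  rewrite Rintegral_independent_pair//; last exact: independent_pair_subset_sum.
  apply: eq_Rintegral => w _.
  rewrite (Rintegral_Fubini PA PB
    (g := fun p : T1 * T2 => f (S D w + X i p.1 + U C p.2))); last first.
    apply/bcomp/measurable_funD; last exact: measurableT_comp.
    by apply: measurable_funD => //; exact: measurableT_comp.
  apply: eq_Rintegral => v _; apply: eq_Rintegral => x _ /=.
  by rewrite addrAC.
have hY : hybrid D = \int[PA]_w \int[PB]_v GY (S D w + U C v).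
  apply: eq_Rintegral => w _.
  pose g (p : R * R) := f (S D w + p.1 + p.2).
  have bg : bounded_measurable g.
    by apply/bcomp/measurable_funD => //; exact: measurable_funD.
  transitivity (\int[PB]_v g (U C v, Y i v)).
    apply: eq_Rintegral => v _.
    by rewrite /U DC subset_sumU1//= /g [Y i v + _]addrC addrA.
  by rewrite Rintegral_independent_pair//; exact: independent_pair_subset_sum.
have bdiff : bounded_measurable (fun z => GX z - GY z).
  exact: bounded_measurableB.
have binner (g : R -> R) : bounded_measurable g ->
    bounded_measurable (fun p : T1 * T2 => g (S D p.1 + U C p.2)).
  move=> [mg gM]; apply: bounded_measurable_comp => //.
  by apply: measurable_funD; exact: measurableT_comp.
have binner1 (g : R -> R) w : bounded_measurable g ->
    bounded_measurable (fun v => g (S D w + U C v)).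
  move=> [mg gM]; apply: bounded_measurable_comp => //.
  exact: measurable_funD.
have Iinner (g : R -> R) : bounded_measurable g ->
    PA.-integrable [set: T1] (EFin \o (fun w => \int[PB]_v g (S D w + U C v))).
  move=> bg; apply: bounded_measurable_integrable.
  exact: (bounded_measurable_Rintegral PB (binner _ bg)).
have zb w v : `|S D w + U C v| <= \sum_(j < n) b j.
  rewrite (bigID (fun j => j \in D))/=.
  apply: le_trans (ler_normD _ _) _; apply: lerD.
    by apply: le_trans (ler_norm_sum _ _ _) _; apply: ler_sum => j _.
  apply: le_trans (ler_norm_sum _ _ _) _.
  rewrite [leRHS](eq_bigl (fun j => j \in (~: D)%SET)); last first.
    by move=> j; rewrite !inE.
  (* The index [i] is absent from the sum, so its share [b i] only has to be nonnegative, which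
     follows from [Xb] at the sample point. *)
  rewrite DC big_setU1//= -[leLHS]add0r; apply: lerD; last exact: ler_sum.
  exact: le_trans (Xb i w).
rewrite hX hY -RintegralB//; [|exact: Iinner|exact: Iinner].
have -> : \int[PA]_w (\int[PB]_v GX (S D w + U C v) -
    \int[PB]_v GY (S D w + U C v)) =
    \int[PA]_w \int[PB]_v (GX (S D w + U C v) - GY (S D w + U C v)).
  apply: eq_Rintegral => w _; rewrite RintegralB//;
    exact/bounded_measurable_integrable/binner1.
apply: normr_Rintegral_le => [|w].
  exact: (bounded_measurable_Rintegral PB (binner _ bdiff)).
apply: normr_Rintegral_le => [|v]; first exact: (binner1 _ w bdiff).
exact/swap/zb.
Qed.

Let hybrid_le D : `|hybrid D - hybrid finset.set0| <= \sum_(i in D) eps i.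
Proof.
elim/finset_ind: D => [|i D iD IH]; first by rewrite subrr normr0 big_set0.
rewrite big_setU1//= (le_trans (ler_distD (hybrid D) _ _))//.
by rewrite lerD// hybrid_swap.
Qed.

Lemma Lindeberg_replacement :
  `|\int[PA]_w f (\sum_(i < n) X i w) - \int[PB]_w f (\sum_(i < n) Y i w)|
  <= \sum_(i < n) eps i.
Proof.
have := hybrid_le finset.setT.
have -> : hybrid finset.setT = \int[PA]_w f (\sum_(i < n) X i w).
  apply: eq_Rintegral => w _.
  rewrite finset.setCT -[RHS](Rintegral_prob_cst PB).
  apply: eq_Rintegral => v _; rewrite /S /U /subset_sum big_set0 addr0.
  by under eq_bigl do rewrite inE.
have -> : hybrid finset.set0 = \int[PB]_w f (\sum_(i < n) Y i w).
  rewrite -[RHS](Rintegral_prob_cst PA); apply: eq_Rintegral => w _.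
  apply: eq_Rintegral => v _.
  rewrite finset.setC0 /S /U /subset_sum big_set0 add0r.
  by under eq_bigl do rewrite inE.
by under [leRHS]eq_bigl do rewrite inE.
Qed.

End Lindeberg.

(** * Taylor expansion *)

Section Taylor.
Variable R : realType.
Implicit Types (f df : R -> R) (C t : R) (m : nat).

Lemma is_derive_continuous_within f df a b :
  (forall t : R, is_derive t 1 f (df t)) -> {within `[a, b], continuous f}.
Proof.
move=> fdf; apply: continuous_subspaceT => t.
by apply/differentiable_continuous/derivable1_diffP.
Qed.

(** The mean value theorem for the difference of the two sides, whose derivative [C * x ^+ m - df x]
    is nonnegative on the positive axis. *)
Lemma ler_primitive_pow f df C m : (forall t : R, is_derive t 1 f (df t)) ->
  f 0 = 0 -> (forall t, 0 <= t -> df t <= C * t ^+ m) ->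
  forall t, 0 <= t -> f t <= C / m.+1%:R * t ^+ m.+1.
Proof.
move=> fdf f0 dfC t t0.
pose p : {poly R} := (C / m.+1%:R) *: 'X^(m.+1).
have hdh (x : R) : is_derive x 1 (horner p - f) (C * x ^+ m - df x).
  apply: is_derive_eq; rewrite /p derivZ derivXn hornerZ hornerMn hornerXn.
  by rewrite mulrnAr -mulrnAl -[_ / _ *+ _]mulr_natr divfK ?pnatr_eq0.
have [x xt] := MVT_segment t0 (fun x _ => hdh x)
  (is_derive_continuous_within hdh).
rewrite !fctE /p !hornerZ !hornerXn f0 expr0n/= mulr0 !subr0 => ht.
move: xt; rewrite in_itv/= => /andP[x0 _].
by rewrite -subr_ge0 ht mulr_ge0// subr_ge0 dfC.
Qed.

(** The one-sided bound for [f] and [- f] gives the absolute value; the reflection [t] to [- t]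
    gives negative arguments. *)
Lemma norm_primitive_pow f df C m : (forall t : R, is_derive t 1 f (df t)) ->
  f 0 = 0 -> (forall t, `|df t| <= C * `|t| ^+ m) ->
  forall t, `|f t| <= C / m.+1%:R * `|t| ^+ m.+1.
Proof.
have pos (g dg : R -> R) : (forall t : R, is_derive t 1 g (dg t)) -> g 0 = 0 ->
    (forall t, `|dg t| <= C * `|t| ^+ m) ->
    forall t, 0 <= t -> `|g t| <= C / m.+1%:R * t ^+ m.+1.
  move=> gdg g0 dgC t t0; rewrite ler_norml lerNl; apply/andP; split.
    apply: (@ler_primitive_pow (- g) (fun x => - dg x)) => //.
      by rewrite fctE g0 oppr0.
    by move=> x x0; rewrite -{2}(ger0_norm x0) (le_trans _ (dgC x))// -normrN ler_norm.
  apply: (@ler_primitive_pow g dg) => //.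
  by move=> x x0; rewrite -{2}(ger0_norm x0) (le_trans _ (dgC x))// ler_norm.
move=> fdf f0 dfC t; have [t0|t0] := leP 0 t.
  by rewrite (ger0_norm t0); exact: (pos f df).
rewrite (ltr0_norm t0) -{1}(opprK t).
apply: (pos (f \o -%R) (fun x => - df (- x))).
- by move=> x; apply: is_derive_eq; rewrite mulrN1.
- by rewrite /= oppr0.
- by move=> x; rewrite normrN (le_trans (dfC _))// normrN.
- by rewrite oppr_ge0 ltW.
Qed.

(** A polynomial in the increment [h], not in the point [z + h]. *)
Definition Taylor_poly (f : R -> R) (z : R) (N : nat) : {poly R} :=
  \poly_(j < N) (derive1n j f z / j`!%:R).

Lemma Taylor_poly_derivn f z N n : (n < N)%N ->
  (Taylor_poly f z N)^`(n).[0] = derive1n n f z.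
Proof.
move=> nN; rewrite horner_coef0 coef_derivn addn0 ffactnn coef_poly nN.
by rewrite -[_ / _ *+ _]mulr_natr divfK// pnatr_eq0 -lt0n fact_gt0.
Qed.

(** [F n] is the derivative of order [n] of the remainder and vanishes at 0 for [n < N]. The bound
    [K] at order [N] is carried down one order at a time by [norm_primitive_pow], whose successive
    divisors build up the factorial. *)
Lemma Taylor_bound (f : R -> R) (K z : R) (N : nat) :
  (forall n, (n < N)%N -> forall x, derivable (derive1n n f) x 1) ->
  (forall x, `|derive1n N f x| <= K) ->
  forall h, `|f (z + h) - (Taylor_poly f z N).[h]| <= K / N`!%:R * `|h| ^+ N.
Proof.
move=> df fK; set T := Taylor_poly f z N.
pose F n : R -> R := (derive1n n f \o shift z) - horner T^`(n).
suff FK m : (m <= N)%N -> forall h, `|F (N - m)%N h| <= K / m`!%:R * `|h| ^+ m.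
  move=> h; have := FK N (leqnn N) h; rewrite subnn /F !fctE/=.
  by rewrite [h + z]addrC.
elim: m => [|m IH] mN h.
  rewrite subn0 fact0 divr1 expr0 mulr1 /F !fctE/=.
  suff -> : T^`(N) = 0 by rewrite horner0 subr0.
  by apply: derivn_poly0; exact: size_poly.
have nN : (N - m.+1 < N)%N by rewrite ltn_subrL; case: (N) mN.
have NmE : (N - m)%N = (N - m.+1).+1 by rewrite subnSK.
rewrite factS natrM invfM [_^-1 * _]mulrC mulrA.
apply: (norm_primitive_pow (df := F (N - m)%N)).
- move=> t; have fdf : is_derive (shift z t) 1 (derive1n (N - m.+1) f)
      (derive1n (N - m.+1).+1 f (shift z t)).
    by apply: DeriveDef; [exact: df|rewrite derive1nS derive1E].
  rewrite NmE; apply: (is_derive_eq (is_deriveB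
    (is_derive1_comp fdf (is_derive_shift t 1 z))
    (is_derive_poly T^`(N - m.+1) t))).
  by rewrite mulr1 /F !fctE -derivnS.
- by rewrite /F !fctE /= Taylor_poly_derivn// add0r subrr.
- exact: (IH (ltnW mN)).
Qed.

End Taylor.

(** * Smooth step function *)

Section smooth_step.
Variable R : realType.

(** The clipping [c] may have a corner at [t], where the chain rule fails. In Caratheodory form,
    [f z - f t = g z * (z - t)] with [g] continuous at [t] and [g t = 0]; setting [g] to 0 at
    clipped points preserves both properties. *)
Lemma is_derive0_clip (f c : R -> R) (t : R) : is_derive t 1 f 0 ->
  (\forall s \near t, c s = s \/ c s = t) -> c t = t ->
  is_derive t 1 (f \o c) 0.
Proof.
move=> /is_derive1_caratheodory[g [fg cg gt]] ct ctt.
pose g' z := if c z == z then g z else 0.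
pose h z := if c z == z then f z else f t.
have g't : g' t = 0 by rewrite /g' ctt eqxx.
apply: (@near_eq_is_derive _ _ _ h).
  near=> s; rewrite /h /=; have [|->] : c s = s \/ c s = t by near: s.
    by move=> ->; rewrite eqxx.
  by case: eqP => // ->.
apply/is_derive1_caratheodory; exists g'; split.
- move=> z; rewrite /h /g' ctt eqxx; case: ifP => _; first exact: fg.
  by rewrite subrr mul0r.
- have {}cg : g @ t --> 0 by rewrite -gt.
  change (g' @ t --> g' t); rewrite g't.
  apply/cvgr0Pnorm_lt => e e0.
  move/cvgr0Pnorm_lt : cg => /(_ e e0); apply: filterS => z ge.
  by rewrite /g'; case: ifP => // _; rewrite normr0.
- exact: g't.
Unshelve. all: by end_near. Qed.

Definition clamp (t : R) : R := Num.max (-1) (Num.min 1 t).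

Lemma clamp_id t : -1 <= t <= 1 -> clamp t = t.
Proof. by move=> /andP[? ?]; rewrite /clamp min_r// max_r. Qed.

Lemma clamp_ge1 t : 1 <= t -> clamp t = 1.
Proof. by move=> t1; rewrite /clamp min_l// max_r//; lra. Qed.

Lemma clamp_leN1 t : t <= -1 -> clamp t = -1.
Proof. by move=> t1; rewrite /clamp min_r ?max_l//; lra. Qed.

Lemma clamp_itv t : -1 <= clamp t <= 1.
Proof.
by rewrite /clamp le_max ge_max ge_min lexx/= lexx /= andbT; lra.
Qed.

(** Away from the corners [clamp] is locally the identity or a constant; at the corners the
    vanishing of [df] makes the two sides fit. The derivative again has the form of a function
    composed with [clamp], so the lemma can be iterated. *)
Lemma is_derive_clamp (f df : R -> R) : (forall x : R, is_derive x 1 f (df x)) ->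
  df 1 = 0 -> df (-1) = 0 ->
  forall t : R, is_derive t 1 (f \o clamp) (df (clamp t)).
Proof.
move=> fdf df1 dfN1 t.
have [t1|t1|->] := ltgtP t 1; last first.
- rewrite clamp_ge1// df1; apply: is_derive0_clip; last exact: clamp_ge1.
    by rewrite -df1.
  near=> s; have [s1|s1] := leP s 1; last by right; exact/clamp_ge1/ltW.
  left; apply: clamp_id; rewrite s1 andbT ltW//.
  by near: s; apply: lt_nbhsr; lra.
- rewrite clamp_ge1 ?ltW// df1; apply: (@near_eq_is_derive _ _ _ (cst (f 1))).
  near=> s; rewrite /= clamp_ge1// ltW//.
  by near: s; exact: lt_nbhsr.
have [t2|t2|->] := ltgtP t (-1); last first.
- rewrite clamp_leN1// dfN1; apply: is_derive0_clip; last exact: clamp_leN1.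
    by rewrite -dfN1.
  near=> s; have [s1|s1] := leP s (-1); first by right; exact/clamp_leN1.
  left; apply: clamp_id; rewrite ltW//= ltW//.
  by near: s; apply: lt_nbhsl; lra.
- rewrite clamp_id; last by rewrite !ltW.
  apply: (@near_eq_is_derive _ _ _ f) => //.
  near=> s; rewrite /= clamp_id//; apply/andP; split; apply: ltW.
  by near: s; exact: lt_nbhsr.
  by near: s; exact: lt_nbhsl.
- rewrite clamp_leN1 ?ltW// dfN1; apply: (@near_eq_is_derive _ _ _ (cst (f (-1)))).
  near=> s; rewrite /= clamp_leN1// ltW//.
  by near: s; exact: lt_nbhsl.
Unshelve. all: by end_near. Qed.

End smooth_step.

Section step.
Variable R : realType.

(* The primitive of [315/256 (1 - t^2)^4] vanishing at [-1]; the factor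
   [315/256] makes its value at [1] equal to [1]. *)
Definition step_poly : {poly R} :=
  (1 / 2)%:P + (315 / 256) *: 'X^1 + (- (105 / 64)) *: 'X^3 +
  (189 / 128) *: 'X^5 + (- (45 / 64)) *: 'X^7 + (35 / 256) *: 'X^9.

Let derivX0 : ('X^0 : {poly R})^`() = 0.
Proof. by rewrite expr0 -[1]/(1%:P) derivC. Qed.

Let derivXS n : ('X^(n.+1) : {poly R})^`() = n.+1%:R *: 'X^n.
Proof. by rewrite derivXn -scaler_nat. Qed.

Let derivnE :=
  (derivn0, derivnS, derivD, derivZ, derivX0, derivXS, derivC, deriv0, scaler0).

Let hornE := (hornerD, hornerZ, hornerXn, hornerC, horner0).

Lemma step_poly1 : step_poly.[1] = 1.
Proof. by rewrite /step_poly !hornE; field. Qed.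

Lemma step_polyN1 : step_poly.[-1] = 0.
Proof. by rewrite /step_poly !hornE; field. Qed.

Lemma deriv_step_poly (t : R) : step_poly^`().[t] = 315 / 256 * (1 - t ^+ 2) ^+ 4.
Proof. by rewrite /step_poly !derivnE !hornE; field. Qed.

(** The first derivative has zeros of order 4 at 1 and -1. With exponent 3 instead of 4 the fourth
    derivative would jump there after clamping. *)
Lemma derivn_step_poly n : (0 < n <= 4)%N ->
  step_poly^`(n).[1] = 0 /\ step_poly^`(n).[-1] = 0.
Proof.
case: n => [|[|[|[|[|n]]]]]// _; split;
  by rewrite /step_poly !derivnE !hornE; field.
Qed.

Lemma step_poly_itv (t : R) : -1 <= t <= 1 -> 0 <= step_poly.[t] <= 1.
Proof.
have mono (a b : R) : a <= b -> step_poly.[a] <= step_poly.[b].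
  move=> ab.
  have [c _ E] := MVT_segment ab (fun x _ => is_derive_poly step_poly x)
    (is_derive_continuous_within (is_derive_poly step_poly)).
  rewrite -subr_ge0 E mulr_ge0 ?subr_ge0// deriv_step_poly.
  apply: mulr_ge0; last exact: exprn_even_ge0.
  by apply: divr_ge0; exact: ler0n.
by move=> /andP[t1 t2]; rewrite -step_polyN1 -{2}step_poly1 !mono.
Qed.

(** Applied to the fourth derivative of [step_poly], this yields the absolute constant of the sign
    estimate. *)
Lemma horner_bounded (p : {poly R}) :
  exists C, forall t : R, -1 <= t <= 1 -> `|p.[t]| <= C.
Proof.
exists (\sum_(i < size p) `|p`_i|) => t; rewrite -ler_norml => t1.
rewrite horner_coef (le_trans (ler_norm_sum _ _ _))// ler_sum// => i _.
by rewrite normrM normrX ler_piMr// exprn_ile1.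
Qed.

Definition smooth_step (alpha t : R) : R := step_poly.[clamp (alpha^-1 * t)].

Lemma smooth_step_itv alpha t : 0 <= smooth_step alpha t <= 1.
Proof. exact/step_poly_itv/clamp_itv. Qed.

Lemma smooth_step_ge alpha t : 0 < alpha -> alpha <= t -> smooth_step alpha t = 1.
Proof.
move=> a0 at_; rewrite /smooth_step clamp_ge1 ?step_poly1//.
by rewrite mulrC ler_pdivlMr// mul1r.
Qed.

Lemma smooth_step_le alpha t : 0 < alpha -> t <= - alpha -> smooth_step alpha t = 0.
Proof.
move=> a0 at_; rewrite /smooth_step clamp_leN1 ?step_polyN1//.
by rewrite mulrC ler_pdivrMr// mulN1r.
Qed.

Lemma smooth_step_K_bounded (C alpha : R) : 0 < alpha ->
  (forall t : R, -1 <= t <= 1 -> `|step_poly^`(4).[t]| <= C) ->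
  K_bounded (C / alpha ^+ 4) (smooth_step alpha).
Proof.
move=> a0 qC.
(* The candidate derivative of order [n]: each differentiation brings out one factor [alpha^-1] and
   keeps the clamped form, because the derivatives of [step_poly] of orders 1 to 4 vanish at both
   corners. *)
pose F n (t : R) : R := alpha^-1 ^+ n * step_poly^`(n).[clamp (alpha^-1 * t)].
have dF n (t : R) : (n < 4)%N -> is_derive t 1 (F n) (F n.+1 t).
  move=> n4.
  have [q1 qN1] := @derivn_step_poly n.+1 n4.
  have dq (x : R) : is_derive x 1 (horner step_poly^`(n)) step_poly^`(n.+1).[x].
    by rewrite derivnS; exact: is_derive_poly.
  have dl : is_derive t 1 (alpha^-1 *: @id R) alpha^-1.
    by apply: is_derive_eq; rewrite /GRing.scale/= mulr1.
  have := is_deriveZ (alpha^-1 ^+ n)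
    (is_derive1_comp (is_derive_clamp dq q1 qN1 _) dl).
  rewrite /F exprSr -mulrA [alpha^-1 * _]mulrC; exact.
have FE n : (n <= 4)%N -> derive1n n (smooth_step alpha) = F n.
  elim: n => [|n IH] n4.
    by apply/funext => t; rewrite /F expr0 mul1r.
  rewrite derive1nS IH ?(ltnW n4)//; apply/funext => t.
  by rewrite derive1E; have dFt := dF n t n4; rewrite derive_val.
split => [n n4 x|x].
  by rewrite FE ?(ltnW n4)//; have dFx := dF n x n4.
rewrite FE// /F normrM mulrC exprVn normfV normrX (gtr0_norm a0).
apply: ler_wpM2r; last exact/qC/clamp_itv.
by rewrite invr_ge0 exprn_ge0// ltW.
Qed.

Lemma sgn_smooth_step alpha t : 0 < alpha ->
  `|sgn t - smooth_step alpha t| <= \1_[set s | - alpha <= s <= alpha] t.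
Proof.
move=> a0; rewrite indicE /sgn.
have [ts|] := boolP (t \in _).
  have /andP[s0 s1] := smooth_step_itv alpha t.
  by rewrite mulr1n; case: ifP => _; rewrite ler_norml; apply/andP; split; lra.
rewrite notin_setE/= => /negP; rewrite negb_and -!ltNge => /orP[ta|ta].
  have t0 : t < 0 by rewrite (lt_trans ta)// oppr_lt0.
  by rewrite (smooth_step_le a0 (ltW ta)) [0 <= t]leNgt t0 subrr normr0.
by rewrite (smooth_step_ge a0 (ltW ta)) (le_trans (ltW a0) (ltW ta)) subrr normr0.
Qed.

End step.

(** * Invariance principle *)

Section moments.
Context d1 d2 (T1 : measurableType d1) (T2 : measurableType d2) (R : realType).
Variables (PA : probability T1 R) (PB : probability T2 R).

Lemma Rintegral_sum d (T : measurableType d) (P : probability T R) (I : Type)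
    (s : seq I) (F : I -> T -> R) : (forall i, bounded_measurable (F i)) ->
  \int[P]_w (\sum_(i <- s) F i w) = \sum_(i <- s) \int[P]_w F i w.
Proof.
move=> bF; elim: s => [|i s IH].
  by under eq_Rintegral do rewrite big_nil; rewrite Rintegral_prob_cst big_nil.
under eq_Rintegral do rewrite big_cons.
rewrite RintegralD// ?IH ?big_cons//; apply: bounded_measurable_integrable => //.
exact: bounded_measurable_sum.
Qed.

Lemma RintegralZ d (T : measurableType d) (P : probability T R) (c : R)
    (F : T -> R) : bounded_measurable F ->
  \int[P]_w (c * F w) = c * \int[P]_w F w.
Proof. by move=> bF; rewrite RintegralZl//; exact: bounded_measurable_integrable. Qed.

Lemma matching_moments_lin (k : nat) (A : 'I_k -> T1 -> R) (B : 'I_k -> T2 -> R)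
    (v : 'I_k -> R) (deg : nat) :
  (forall j, bounded_measurable (A j)) -> (forall j, bounded_measurable (B j)) ->
  matching_moments PA PB A B deg ->
  forall m, (m <= deg)%N ->
    \int[PA]_w (\sum_(j < k) v j * A j w) ^+ m =
    \int[PB]_w (\sum_(j < k) v j * B j w) ^+ m.
Proof.
move=> bA bB match_.
pose X w := \sum_(j < k) v j * A j w.
pose Y w := \sum_(j < k) v j * B j w.
have bX : bounded_measurable X.
  apply: bounded_measurable_sum => j; apply: bounded_measurableM => //.
  exact: bounded_measurable_cst.
have bY : bounded_measurable Y.
  apply: bounded_measurable_sum => j; apply: bounded_measurableM => //.
  exact: bounded_measurable_cst.
have bprodA s m : bounded_measurable (fun w => \prod_(j <- s) A j w * X w ^+ m).
  by apply: bounded_measurableM;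
    [exact: bounded_measurable_prod|exact: bounded_measurableX].
have bprodB s m : bounded_measurable (fun w => \prod_(j <- s) B j w * Y w ^+ m).
  by apply: bounded_measurableM;
    [exact: bounded_measurable_prod|exact: bounded_measurableX].
(* Generalised by a monomial factor indexed by [s]: each induction step moves one factor of the
   power into [s], preserving the total degree [size s + m], until only a moment covered by [match_]
   is left. *)
suff H m (s : seq 'I_k) : (size s + m <= deg)%N ->
    \int[PA]_w (\prod_(j <- s) A j w * X w ^+ m) =
    \int[PB]_w (\prod_(j <- s) B j w * Y w ^+ m).
  move=> m mdeg; have := H m [::] mdeg.
  under eq_Rintegral do rewrite big_nil mul1r.
  by under [in X in _ = X -> _]eq_Rintegral do rewrite big_nil mul1r.
elim: m s => [|m IH] s sdeg.
  have := match_ s; rewrite addn0 in sdeg => /(_ sdeg).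
  rewrite !expectation_Rintegral; [|exact: bounded_measurable_prod..].
  case=> E; under eq_Rintegral do rewrite expr0 mulr1.
  by rewrite E; under [RHS]eq_Rintegral do rewrite expr0 mulr1.
have expand (Z : 'I_k -> R) : \prod_(j <- s) Z j * (\sum_j v j * Z j) ^+ m.+1 =
    \sum_j v j * (\prod_(i <- j :: s) Z i * (\sum_i v i * Z i) ^+ m).
  rewrite exprS mulrCA mulr_suml; apply: eq_bigr => j _.
  by rewrite big_cons !mulrA.
under eq_Rintegral do rewrite expand.
under [RHS]eq_Rintegral do rewrite expand.
rewrite !Rintegral_sum; last 2 first.
- move=> j; apply: bounded_measurableM; first exact: bounded_measurable_cst.
  exact: bprodB.
- move=> j; apply: bounded_measurableM; first exact: bounded_measurable_cst.
  exact: bprodA.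
apply: eq_bigr => j _.
rewrite (RintegralZ _ _ (bprodA (j :: s) m)) (RintegralZ _ _ (bprodB (j :: s) m)).
by rewrite IH//= addSn -addnS.
Qed.

Lemma continuous_bounded_on (f : R -> R) (M : R) : continuous f ->
  exists C, forall x, `|x| <= M -> `|f x| <= C.
Proof.
move=> cf; have : compact (f @` `[- M, M]).
  apply: continuous_compact; last exact: segment_compact.
  exact: continuous_subspaceT.
move=> /compact_bounded[C [_ fC]]; exists (C + 1) => x xM.
by apply: (fC (C + 1)); [rewrite ltrDl|exists x => //=; rewrite in_itv/= -ler_norml].
Qed.

Lemma K_bounded_continuous (K : R) (Psi : R -> R) : K_bounded K Psi -> continuous Psi.
Proof.
move=> [dPsi _] x.
exact/differentiable_continuous/derivable1_diffP/(dPsi 0%N).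
Qed.

Lemma moment_comparison (K : R) (Psi : R -> R) (z b : R) (X : T1 -> R)
    (Y : T2 -> R) : K_bounded K Psi ->
  measurable_fun [set: T1] X -> measurable_fun [set: T2] Y ->
  (forall w, `|X w| <= b) -> (forall w, `|Y w| <= b) ->
  (forall m, (m <= 3)%N -> \int[PA]_w X w ^+ m = \int[PB]_w Y w ^+ m) ->
  `|\int[PA]_w Psi (z + X w) - \int[PB]_w Psi (z + Y w)| <= K * b ^+ 4.
Proof.
move=> KPsi mX mY Xb Yb XY.
have cPsi := K_bounded_continuous KPsi.
have [dPsi PsiK] := KPsi.
have K0 : 0 <= K := le_trans (normr_ge0 _) (PsiK 0).
pose p := Taylor_poly Psi z 4.
pose r h := Psi (z + h) - p.[h].
have rb h : `|h| <= b -> `|r h| <= K / 24 * b ^+ 4.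
  move=> hb; rewrite (le_trans (Taylor_bound _ dPsi PsiK _))//.
  have -> : (4`! = 24)%N by [].
  apply: ler_wpM2l; first by rewrite divr_ge0.
  by rewrite lerXn2r// nnegrE (le_trans _ hb).
have pE h : p.[h] = \sum_(j < 4) p`_j * h ^+ j.
  by rewrite (horner_coef_wide _ (size_poly _ _)).
have mp : measurable_fun [set: R] (horner p).
  by apply: continuous_measurable_fun; exact: continuous_horner.
have mPsi : measurable_fun [set: R] Psi by exact: continuous_measurable_fun.
have decomp d (T : measurableType d) (P : probability T R) (Z : T -> R) :
    measurable_fun [set: T] Z -> (forall w, `|Z w| <= b) ->
    bounded_measurable (fun w => r (Z w)) /\
    \int[P]_w Psi (z + Z w) =
    \sum_(j < 4) p`_j * \int[P]_w Z w ^+ j + \int[P]_w r (Z w).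
  move=> mZ Zb.
  have bZ : bounded_measurable Z by split => //; exists b.
  have brZ : bounded_measurable (fun w => r (Z w)).
    split; last by exists (K / 24 * b ^+ 4) => w; exact: rb.
    apply: measurable_funB; apply: measurableT_comp => //.
    exact: measurable_funD.
  split => //.
  have bterm j : bounded_measurable (fun w => p`_j * Z w ^+ j).
    apply: bounded_measurableM; first exact: bounded_measurable_cst.
    exact: bounded_measurableX.
  transitivity (\int[P]_w (\sum_(j < 4) p`_j * Z w ^+ j + r (Z w))).
    by apply: eq_Rintegral => w _; rewrite /r pE [RHS]addrC subrK.
  rewrite RintegralD//; last 2 first.
  - apply: bounded_measurable_integrable.
    exact: (bounded_measurable_sum _ _ (fun j : 'I_4 => bterm j)).
  - exact: bounded_measurable_integrable.
  rewrite Rintegral_sum//; congr (_ + _); apply: eq_bigr => j _.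
  by rewrite RintegralZ//; exact: bounded_measurableX.
have [brX ->] := decomp _ _ PA X mX Xb.
have [brY ->] := decomp _ _ PB Y mY Yb.
rewrite (eq_bigr (fun j : 'I_4 => p`_j * \int[PB]_w Y w ^+ j)); last first.
  by move=> j _; rewrite XY// -ltnS.
rewrite [X in `|X|](_ : _ = \int[PA]_w r (X w) - \int[PB]_w r (Y w)); last by lra.
rewrite (le_trans (ler_normB _ _))//.
have /(normr_Rintegral_le PA brX) rX w : `|r (X w)| <= K / 24 * b ^+ 4 by exact: rb.
have /(normr_Rintegral_le PB brY) rY w : `|r (Y w)| <= K / 24 * b ^+ 4 by exact: rb.
rewrite (le_trans (lerD rX rY))//.
(* The two remainders add up to [K / 12 * b ^+ 4], which is relaxed to the stated bound. *)
by have : 0 <= K * b ^+ 4 by [rewrite mulr_ge0// exprn_even_ge0]; lra.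
Qed.

End moments.

Section invariance.
Context d1 d2 (T1 : measurableType d1) (T2 : measurableType d2) (R : realType).
Variables (PA : probability T1 R) (PB : probability T2 R).

Lemma bounded_measurable_bound1 d (T : measurableType d) (X : T -> R) :
  measurable_fun [set: T] X -> (forall w, `|X w| <= 1) -> bounded_measurable X.
Proof. by move=> mX X1; split => //; exists 1. Qed.

Lemma norm_lin_le (T : Type) (k : nat) (v : 'I_k -> R) (X : 'I_k -> T -> R) w :
  (forall j w, `|X j w| <= 1) -> `|\sum_(j < k) v j * X j w| <= norm1 v.
Proof.
move=> X1; rewrite (le_trans (ler_norm_sum _ _ _))// ler_sum// => j _.
by rewrite normrM ler_piMr.
Qed.

Lemma measurable_lin d (T : measurableType d) (k : nat) (v : 'I_k -> R)
    (X : 'I_k -> T -> R) : (forall j, measurable_fun [set: T] (X j)) ->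
  measurable_fun [set: T] (fun w => \sum_(j < k) v j * X j w).
Proof.
by move=> mX; apply: measurable_sum => j; exact: measurable_funM.
Qed.

Lemma norm_lin_form_le (T : Type) (n : nat) (k : 'I_n -> nat)
    (l : forall i : 'I_n, 'I_(k i) -> R) (X : forall i : 'I_n, 'I_(k i) -> T -> R) w :
  (forall i j w, `|X i j w| <= 1) -> `|lin_form l X w| <= \sum_(i < n) norm1 (l i).
Proof.
move=> X1; rewrite (le_trans (ler_norm_sum _ _ _))// ler_sum// => i _.
exact: norm_lin_le.
Qed.

Lemma measurable_lin_form d (T : measurableType d) (n : nat) (k : 'I_n -> nat)
    (l : forall i : 'I_n, 'I_(k i) -> R) (X : forall i : 'I_n, 'I_(k i) -> T -> R) :
  (forall i j, measurable_fun [set: T] (X i j)) ->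
  measurable_fun [set: T] (lin_form l X).
Proof. by move=> mX; apply: measurable_sum => i; exact: measurable_lin. Qed.

Lemma bounded_measurable_lin_form d (T : measurableType d) (n : nat)
    (k : 'I_n -> nat) (l : forall i : 'I_n, 'I_(k i) -> R)
    (X : forall i : 'I_n, 'I_(k i) -> T -> R) (f : R -> R) (theta : R) :
  (forall i j, measurable_fun [set: T] (X i j)) ->
  (forall i j w, `|X i j w| <= 1) -> continuous f ->
  bounded_measurable (fun w => f (lin_form l X w - theta)).
Proof.
move=> mX X1 cf.
have [C fC] := continuous_bounded_on (\sum_(i < n) norm1 (l i) + `|theta|) cf.
split; last first.
  exists C => w; apply: fC; rewrite (le_trans (ler_normB _ _))// lerD2r.
  exact: norm_lin_form_le.
apply: measurableT_comp; first exact: continuous_measurable_fun.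
by apply: measurable_funB => //; exact: measurable_lin_form.
Qed.

Variables (n : nat) (k : 'I_n -> nat).
Variables (A : forall i : 'I_n, 'I_(k i) -> T1 -> R)
  (B : forall i : 'I_n, 'I_(k i) -> T2 -> R) (l : forall i : 'I_n, 'I_(k i) -> R).
Arguments A : clear implicits.
Arguments B : clear implicits.
Arguments l : clear implicits.
Hypotheses (mA : forall i j, measurable_fun [set: T1] (A i j))
  (mB : forall i j, measurable_fun [set: T2] (B i j)).
Hypothesis match3 : forall i, matching_moments PA PB (A i) (B i) 3.
Hypotheses (A1 : forall i j w, `|A i j w| <= 1)
  (B1 : forall i j w, `|B i j w| <= 1).
Hypotheses (indepA : mutually_independent_ensembles PA A)
  (indepB : mutually_independent_ensembles PB B).

Lemma invariance_K_bounded (K : R) (Psi : R -> R) (theta : R) :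
  K_bounded K Psi ->
  `|\int[PA]_w Psi (lin_form l A w - theta) -
    \int[PB]_w Psi (lin_form l B w - theta)|
  <= K * \sum_(i < n) norm1 (l i) ^+ 4.
Proof.
move=> KPsi; have cPsi := K_bounded_continuous KPsi.
pose b i := norm1 (l i).
have b0 i : 0 <= b i by apply: sumr_ge0.
pose M := \sum_(i < n) b i.
have bM i : b i <= M by rewrite /M (bigD1 i)//= lerDl sumr_ge0.
pose X i w := \sum_(j < k i) l i j * A i j w.
pose Y i w := \sum_(j < k i) l i j * B i j w.
have Xb i w : `|X i w| <= b i by exact: norm_lin_le.
have Yb i w : `|Y i w| <= b i by exact: norm_lin_le.
have mX i : measurable_fun [set: T1] (X i) by exact: measurable_lin.
have mY i : measurable_fun [set: T2] (Y i) by exact: measurable_lin.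
(* [Psi] may be unbounded, but only its values on a compact interval matter. *)
pose f x := if `|x| <= M + M then Psi (x - theta) else 0.
have fE x : `|x| <= M + M -> f x = Psi (x - theta) by rewrite /f => ->.
have bf : bounded_measurable f.
  have [C PsiC] := continuous_bounded_on (M + M + `|theta|) cPsi.
  split; last first.
    exists `|C| => x; rewrite /f; case: ifP => [xM|_]; last by rewrite normr0.
    apply: le_trans (PsiC _ _) (ler_norm _).
    by rewrite (le_trans (ler_normB _ _))// lerD2r.
  apply: measurable_fun_ifT => //.
    by apply: measurable_fun_ler => //; exact: measurableT_comp.
  apply: measurableT_comp; first exact: continuous_measurable_fun.
  exact: measurable_funB.
have := Lindeberg_replacement (PA := PA) (PB := PB) (eps := fun i => K * b i ^+ 4)
  mX mY Xb Yb (independent_lin l indepA) (independent_lin l indepB) bf.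
rewrite -mulr_sumr.
have -> : \int[PA]_w f (\sum_(i < n) X i w) =
    \int[PA]_w Psi (lin_form l A w - theta).
  apply: eq_Rintegral => w _; rewrite fE//.
  rewrite (le_trans (ler_norm_sum _ _ _))// (@le_trans _ _ M)// ?ler_sum//.
  by rewrite lerDl sumr_ge0.
have -> : \int[PB]_w f (\sum_(i < n) Y i w) =
    \int[PB]_w Psi (lin_form l B w - theta).
  apply: eq_Rintegral => w _; rewrite fE//.
  rewrite (le_trans (ler_norm_sum _ _ _))// (@le_trans _ _ M)// ?ler_sum//.
  by rewrite lerDl sumr_ge0.
apply => i z zM.
(* Since [z] and [Z w] are each at most [M] in absolute value, their sum stays where [f] agrees with
   [Psi]; the shift [theta] is absorbed into the base point. *)
have swapE d (T : measurableType d) (P : probability T R) (Z : T -> R) :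
    (forall w, `|Z w| <= b i) ->
    \int[P]_w f (z + Z w) = \int[P]_w Psi (z - theta + Z w).
  move=> Zb; apply: eq_Rintegral => w _; rewrite fE 1?addrAC//.
  by rewrite (le_trans (ler_normD _ _))// lerD// (le_trans (Zb w)).
rewrite !swapE//; apply: moment_comparison => //.
by apply: matching_moments_lin => // j; exact: bounded_measurable_bound1.
Qed.

Lemma bounded_measurable_sgn d (T : measurableType d) (L : T -> R) (theta : R) :
  measurable_fun [set: T] L -> bounded_measurable (fun w => sgn (L w - theta)).
Proof.
move=> mL; split; last first.
  by exists 1 => w; rewrite /sgn; case: ifP => _; rewrite ?normr1// normr0.
apply: measurable_fun_ifT => //.
by apply: measurable_fun_ler => //; exact: measurable_funB.
Qed.

(** The pointwise error is at most the indicator of [E], and [P E] is the member of the supremum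
    with centre [theta]. *)
Lemma Rintegral_sgn_smooth_step d (T : measurableType d) (P : probability T R)
    (L : T -> R) (theta alpha : R) :
  measurable_fun [set: T] L -> 0 < alpha ->
  (`|\int[P]_w sgn (L w - theta) - \int[P]_w smooth_step alpha (L w - theta)|%:E
   <= max_interval_prob P L alpha)%E.
Proof.
move=> mL a0.
pose E : set T := [set w | theta - alpha <= L w <= theta + alpha].
have mE : measurable E.
  have -> : E = L @^-1` `[theta - alpha, theta + alpha].
    by apply/seteqP; split => w; rewrite /E /= in_itv.
  by rewrite -[_ @^-1` _]setTI; apply: mL.
have [C qC] := horner_bounded (step_poly R)^`(4).
have cstep := K_bounded_continuous (smooth_step_K_bounded a0 qC).
have bstep : bounded_measurable (fun w => smooth_step alpha (L w - theta)).
  split; last first.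
    exists 1 => w; have /andP[s0 s1] := smooth_step_itv alpha (L w - theta).
    by rewrite ger0_norm.
  apply: measurableT_comp; first exact: continuous_measurable_fun.
  exact: measurable_funB.
have bsgn := bounded_measurable_sgn theta mL.
have bdiff : bounded_measurable
    (fun w => sgn (L w - theta) - smooth_step alpha (L w - theta)).
  exact: bounded_measurableB.
have bind : bounded_measurable (\1_E : T -> R).
  split; first exact: measurable_indic.
  by exists 1 => w; rewrite indicE; case: (_ \in _); rewrite ?normr1 ?normr0.
apply: (@le_trans _ _ (P E)); last by apply: ereal_sup_ubound; exists theta.
have -> : P E = (\int[P]_w \1_E w)%:E.
  by rewrite -expectation_Rintegral// expectation_indic.
rewrite lee_fin -RintegralB//; [|exact: bounded_measurable_integrable..].
apply: le_trans (le_normr_Rintegral measurableT _) _.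
  exact: bounded_measurable_integrable.
apply: le_Rintegral => //.
- apply: bounded_measurable_integrable; case: bdiff => mdiff [N hN]; split.
    exact: measurableT_comp.
  by exists N => w; rewrite normr_id.
- exact: bounded_measurable_integrable.
- move=> w _; rewrite (le_trans (sgn_smooth_step _ a0))// !indicE.
  rewrite (_ : (_ \in _) = (w \in E))//.
  by apply/idP/idP; rewrite !inE /E/= => /andP[h1 h2]; apply/andP; split; lra.
Qed.

End invariance.

Theorem theorem2p9 (R : realType) :
  exists C : R,
  forall (d1 d2 : measure_display) (T1 : measurableType d1) (T2 : measurableType d2)
    (PA : probability T1 R) (PB : probability T2 R)
    (n : nat) (k : 'I_n -> nat)
    (A : forall i : 'I_n, 'I_(k i) -> T1 -> R)
    (B : forall i : 'I_n, 'I_(k i) -> T2 -> R),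
    (forall i j, measurable_fun [set: T1] (A i j)) ->
    (forall i j, measurable_fun [set: T2] (B i j)) ->
    (forall i, matching_moments PA PB (A i) (B i) 3) ->
    (forall i j w, `|A i j w| <= 1) ->
    (forall i j w, `|B i j w| <= 1) ->
    mutually_independent_ensembles PA A ->
    mutually_independent_ensembles PB B ->
  forall l : forall i : 'I_n, 'I_(k i) -> R,
    (forall (K : R) (Psi : R -> R) (theta : R), K_bounded K Psi ->
       (`| 'E_PA[fun w => Psi (lin_form l A w - theta)%R]
          - 'E_PB[fun w => Psi (lin_form l B w - theta)%R] |
        <= (K * \sum_(i < n) norm1 (l i) ^+ 4)%:E)%E)
    /\
    (forall (alpha theta' : R), 0 < alpha -> alpha < 1 / 2 ->
       (`| 'E_PA[fun w => sgn (lin_form l A w - theta')%R]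
          - 'E_PB[fun w => sgn (lin_form l B w - theta')%R] |
        <= (C / alpha ^+ 4 * \sum_(i < n) norm1 (l i) ^+ 4)%:E
           + 2%:E * maxe (max_interval_prob PA (lin_form l A) alpha)
                         (max_interval_prob PB (lin_form l B) alpha))%E).
Proof.
(* [C] is fixed by [step_poly] alone, before the spaces, the ensembles and [alpha] are
   introduced. *)
have [C qC] := horner_bounded (step_poly R)^`(4).
exists C => d1 d2 T1 T2 PA PB n k A B mA mB match3 A1 B1 indepA indepB l.
split=> [K Psi theta KPsi|alpha theta a0 _].
  have cPsi := K_bounded_continuous KPsi.
  rewrite !expectation_Rintegral; [|exact: bounded_measurable_lin_form..].
  by rewrite -EFinB abse_EFin lee_fin; exact: invariance_K_bounded.
have mLA := measurable_lin_form l mA.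
have mLB := measurable_lin_form l mB.
rewrite !expectation_Rintegral; [|exact: bounded_measurable_sgn..].
rewrite -EFinB abse_EFin.
have := invariance_K_bounded l mA mB match3 A1 B1 indepA indepB theta
  (smooth_step_K_bounded a0 qC).
have := Rintegral_sgn_smooth_step PA theta mLA a0.
have := Rintegral_sgn_smooth_step PB theta mLB a0.
set a := \int[PA]_w sgn _; set b := \int[PB]_w sgn _.
set a' := \int[PA]_w smooth_step _ _; set b' := \int[PB]_w smooth_step _ _.
set mxA := max_interval_prob PA _ _; set mxB := max_interval_prob PB _ _.
move=> bb' aa' a'b'.
(* The first term is the smooth comparison; each of the other two is a smoothing error, paid for by
   one copy of the maximum. *)
have tri : `|a - b| <= `|a' - b'| + (`|a - a'| + `|b - b'|).
  rewrite (_ : a - b = (a' - b') + ((a - a') - (b - b'))); last by lra.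
  rewrite (le_trans (ler_normD _ _))// lerD2l.
  exact: ler_normB.
have -> : (2%:E * maxe mxA mxB = maxe mxA mxB + maxe mxA mxB)%E by rewrite mule_natl.
rewrite (@le_trans _ _ (`|a' - b'| + (`|a - a'| + `|b - b'|))%:E)//.
rewrite !EFinD leeD ?lee_fin// leeD//.
  by rewrite (le_trans aa')// le_max lexx.
by rewrite (le_trans bb')// le_max lexx orbT.
Qed.
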